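(* Fix finite nonempty sets $A$ and $\Omega$, a prior $\mu_0$ on $\Omega$ with $\mu_0(\omega)>0$ for all $\omega$, and a finite message set $M$ with $|M|>\max\{|\Omega|,|A|\}$. Then there is a set of environments of Lebesgue measure one in $[0,1]^{2|A||\Omega|}$ such that, for every environment $(u_S,u_R)$ in this set, commitment is valuable if and only if committed Sender values randomization.
   Context: An environment is a pair $(u_S,u_R)$ of functions $A\times\Omega\to[0,1]$; the set of environments is identified with $[0,1]^{2|A||\Omega|}$. A messaging strategy is a map $\sigma:\Omega\to\Delta M$, written $\sigma(m|\omega)$. An action strategy is a map $\rho:M\to\Delta A$, written $\rho(a|m)$. For $i\in\{S,R\}$ let $U_i(\sigma,\rho)=\sum_{\omega,m,a}\mu_0(\omega)\sigma(m|\omega)\rho(a|m)u_i(a,\omega)$. A profile $(\sigma,\rho)$ is S-BR if $\sigma$ maximizes $U_S(\cdot,\rho)$ over all messaging strategies. It is R-BR if $\rho$ maximizes $U_R(\sigma,\cdot)$ over all action strategies. A persuasion profile is an R-BR profile, and the persuasion payoff is the maximum of $U_S$ over persuasion profiles. A cheap-talk equilibrium is a profile that is both S-BR and R-BR, and the cheap-talk payoff is the maximum of $U_S$ over cheap-talk equilibria. Commitment is valuable if the persuasion payoff is strictly greater than the cheap-talk payoff. A messaging strategy $\sigma$ is partitional if for every $\omega$ there is $m$ with $\sigma(m|\omega)=1$. The partitional persuasion payoff is the maximum of $U_S$ over persuasion profiles $(\sigma,\rho)$ with $\sigma$ partitional. Committed Sender values randomization if the persuasion payoff is strictly greater than the partitional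 persuasion payoff. *)

(* Defs.v *)
From HB Require Import structures.
From mathcomp Require Import all_boot all_order all_algebra.
From mathcomp Require Import boolp classical_sets reals.
Set Implicit Arguments. Unset Strict Implicit. Unset Printing Implicit Defensive.
Import Order.TTheory GRing.Theory Num.Theory.
Local Open Scope ring_scope.
Local Open Scope classical_set_scope.

Section Game.
Variables (R : realType) (A Omega M : finType).

Definition is_dist (T : finType) (p : T -> R) : Prop :=
  (forall t, 0 <= p t) /\ \sum_(t : T) p t = 1.

Definition messaging (sigma : Omega -> M -> R) : Prop :=
  forall w, is_dist (sigma w).
Definition action_strat (rho : M -> A -> R) : Prop :=
  forall m, is_dist (rho m).

Variable mu0 : Omega -> R.

Definition payoff (u : A -> Omega -> R) (sigma : Omega -> M -> R)
    (rho : M -> A -> R) : R :=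
  \sum_(w : Omega) \sum_(m : M) \sum_(a : A)
     mu0 w * sigma w m * rho m a * u a w.

Variables (uS uR : A -> Omega -> R).

Definition S_BR sigma rho : Prop :=
  forall sigma', messaging sigma' -> payoff uS sigma' rho <= payoff uS sigma rho.
Definition R_BR sigma rho : Prop :=
  forall rho', action_strat rho' -> payoff uR sigma rho' <= payoff uR sigma rho.

Definition persuasion_profile sigma rho : Prop :=
  messaging sigma /\ action_strat rho /\ R_BR sigma rho.
Definition cheap_talk_eq sigma rho : Prop :=
  messaging sigma /\ action_strat rho /\ S_BR sigma rho /\ R_BR sigma rho.
Definition partitional (sigma : Omega -> M -> R) : Prop :=
  forall w, exists m, sigma w m = 1.

(* The payoffs are maxima; they are attained, so they equal these suprema. *)
Definition persuasion_payoff : R :=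
  sup [set x | exists sigma rho,
        persuasion_profile sigma rho /\ x = payoff uS sigma rho].
Definition cheap_talk_payoff : R :=
  sup [set x | exists sigma rho,
        cheap_talk_eq sigma rho /\ x = payoff uS sigma rho].
Definition partitional_persuasion_payoff : R :=
  sup [set x | exists sigma rho,
        persuasion_profile sigma rho /\ partitional sigma /\ x = payoff uS sigma rho].

Definition commitment_valuable : Prop :=
  cheap_talk_payoff < persuasion_payoff.
Definition values_randomization : Prop :=
  partitional_persuasion_payoff < persuasion_payoff.

End Game.

Definition env_uS (R : realType) (A Omega : finType)
  (e : (bool * A * Omega)%type -> R) : A -> Omega -> R := fun a w => e (true, a, w).
Definition env_uR (R : realType) (A Omega : finType)
  (e : (bool * A * Omega)%type -> R) : A -> Omega -> R := fun a w => e (false, a, w).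

Definition in_box (R : realType) (I : finType) (l u : I -> R) (x : I -> R) : Prop :=
  forall i, l i <= x i <= u i.
Definition box_vol (R : realType) (I : finType) (l u : I -> R) : R :=
  \prod_(i : I) (u i - l i).
Definition lebesgue_null (R : realType) (I : finType) (N : set (I -> R)) : Prop :=
  forall eps : R, 0 < eps ->
  exists (l u : nat -> I -> R),
    (forall k i, l k i <= u k i) /\
    (forall x, N x -> exists k, in_box (l k) (u k) x) /\
    (forall n, \sum_(k < n) box_vol (l k) (u k) <= eps).

(* Main.v *)
Require Import Defs.
From HB Require Import structures.
From mathcomp Require Import all_boot all_order all_algebra.
From mathcomp Require Import ring lra.
From mathcomp Require Import boolp classical_sets reals.
From mathcomp Require Import topology normedtype derive.
Set Implicit Arguments. Unset Strict Implicit. Unset Printing Implicit Defensive.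
Import Order.TTheory GRing.Theory Num.Theory.
Import numFieldNormedType.Exports ArrowAsProduct.
Local Open Scope ring_scope.
Local Open Scope classical_set_scope.

(** By compactness all three payoffs are attained, so it suffices to show that,
    generically, some cheap-talk equilibrium is an optimal persuasion profile
    iff some partitional persuasion profile is optimal.

    If a partitional profile is optimal, generically Receiver's replies to it
    are strict.  A state that strictly prefers another on-path message could
    then be diverted to it with small probability without changing any reply,
    contradicting optimality; hence the profile is a cheap-talk equilibrium.

    Conversely, let an optimal profile [(sigma, rho)] be a cheap-talk
    equilibrium.  Keeping [rho], move [sigma] to a vertex of the polytope of
    strategies with the same support to which [rho] is a best reply; this keeps
    Sender's best-reply property, hence optimality.  The vertex is the unique
    solution of one of finitely many linear systems whose coefficients involve
    only [u_R].  By optimality Sender is indifferent over the actions in the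
    support of each on-path reply; for the given vertex this is a nontrivial
    linear equation in [u_S], hence fails generically unless the replies are
    pure.  Once replies are pure, strictness of Sender's preferences in each
    state turns [sigma] into a partition.

    The exceptional sets are countable unions of Lipschitz graphs over a
    coordinate hyperplane. *)

(** * Null sets *)

Section NullSets.
Variables (R : realType) (I : finType) (i0 : I).
Implicit Types (N : set (I -> R)) (l u : I -> R).

Lemma box_vol_ge0 l u : (forall i, l i <= u i) -> 0 <= box_vol l u.
Proof. by move=> lu; apply: prodr_ge0 => i _; rewrite subr_ge0. Qed.

(** Covers may be indexed by any countable type, with all finite partial sums bounded. The
    coordinate [i0] makes a one-point box have volume 0, since an empty product would be 1. *)
Lemma lebesgue_null_countable_cover N :
  (forall eps : R, 0 < eps -> exists (K : countType) (l u : K -> I -> R),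
     [/\ forall k i, l k i <= u k i,
         forall x, N x -> exists k, in_box (l k) (u k) x &
         forall s : seq K, uniq s -> \sum_(k <- s) box_vol (l k) (u k) <= eps]) ->
  lebesgue_null N.
Proof.
move=> H eps eps0; have [K [l [u [lu cov small]]]] := H eps eps0.
(* Numbers that code no index receive the degenerate box at the origin. *)
pose ext (f : K -> I -> R) p := oapp f (fun=> 0) (pickle_inv p).
exists (ext l), (ext u); split.
  by move=> p i; rewrite /ext; case: (pickle_inv p) => /=.
split.
  move=> x /cov[k kx]; exists (pickle k).
  by rewrite /ext pickleK_inv.
move=> n; have := small (pmap pickle_inv (iota 0 n)).
rewrite (pmap_uniq (@pickle_invK K)) ?iota_uniq // big_pmap => /(_ isT).
apply: le_trans; rewrite -(big_mkord xpredT (fun p => box_vol (ext l p) (ext u p)))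
  /index_iota subn0.
apply: ler_sum => p _; rewrite /ext; case: (pickle_inv p) => //=.
by rewrite /box_vol (bigD1 i0) //= subrr mul0r.
Qed.

Lemma lebesgue_null_sub N N' : N `<=` N' -> lebesgue_null N' -> lebesgue_null N.
Proof.
move=> sub null eps /null[l [u [lu [cov small]]]].
by exists l, u; split=> //; split=> // x /sub/cov.
Qed.

Lemma lebesgue_null0 : lebesgue_null (set0 : set (I -> R)).
Proof.
move=> eps eps0; exists (fun _ _ => 0), (fun _ _ => 0); split=> //; split=> // n.
by rewrite big1 ?ltW // => k _; rewrite /box_vol (bigD1 i0) //= subrr mul0r.
Qed.

(** The finitely many pairs fit in a square of side [b]; row [n] of it contributes at most
    [c / 2 ^+ n.+1], and these bounds sum to [c - c / 2 ^+ b]. *)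
Lemma sum_uniq_pair_le (F : nat * nat -> R) (c : R) (s : seq (nat * nat)) :
  (forall p, 0 <= F p) -> uniq s ->
  (forall n m, \sum_(k < m) F (n, k : nat) <= c / 2 ^+ n.+1) -> 0 <= c ->
  \sum_(p <- s) F p <= c.
Proof.
move=> F0 us Fc c0.
pose b := (\max_(p <- s) maxn p.1 p.2).+1.
have bP p : p \in s -> (p.1 < b)%N && (p.2 < b)%N.
  move=> ps; rewrite /b !ltnS -geq_max.
  by rewrite (big_rem p) //= leq_maxl.
have -> : \sum_(p <- s) F p =
    \sum_(p : 'I_b * 'I_b | (p.1 : nat, p.2 : nat) \in s) F (p.1 : nat, p.2 : nat).
  pose h (p : nat * nat) : 'I_b * 'I_b := (inord p.1, inord p.2).
  have hK p : p \in s -> (nat_of_ord (h p).1, nat_of_ord (h p).2) = p.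
    by move=> /bP/andP[p1 p2]; rewrite /= !inordK //; case: p p1 p2.
  have uh : uniq (map h s).
    rewrite map_inj_in_uniq // => p q ps qs hpq.
    by rewrite -(hK p ps) -(hK q qs) hpq.
  transitivity (\sum_(p <- map h s) F (p.1 : nat, p.2 : nat)).
    by rewrite big_map; apply: eq_big_seq => p /hK ->.
  rewrite big_uniq //=; apply: eq_bigl => p.
  apply/mapP/idP => [[q qs ->]|ps]; first by rewrite hK.
  by exists (p.1 : nat, p.2 : nat) => //; rewrite /h /= !inord_val; case: p {ps}.
apply: (@le_trans _ _ (\sum_(p : 'I_b * 'I_b) F (p.1 : nat, p.2 : nat))).
  by rewrite [leLHS]big_mkcond; apply: ler_sum => p _; case: ifP => _.
rewrite -(pair_big xpredT xpredT (fun n m : 'I_b => F (n : nat, m : nat))) /=.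
apply: (@le_trans _ _ (\sum_(n < b) c / 2 ^+ n.+1)).
  by apply: ler_sum => n _; apply: Fc.
have -> : \sum_(n < b) c / 2 ^+ n.+1 = c - c / 2 ^+ b.
  elim: b {bP} => [|b IH]; first by rewrite big_ord0 expr0 divr1 subrr.
  rewrite big_ord_recr /= IH exprS.
  have : 2 ^+ b != 0 :> R by rewrite expf_neq0 ?pnatr_eq0.
  by move: (2 ^+ b) => p p0; field.
by rewrite gerBl divr_ge0 ?exprn_ge0.
Qed.

(** The set with code [n] is covered within [eps / 2 ^+ n.+1]; numbers coding no index stand for the
    empty set. *)
Lemma lebesgue_null_bigcup (K : countType) (N : K -> set (I -> R)) :
  (forall k, lebesgue_null (N k)) -> lebesgue_null (\bigcup_k N k).
Proof.
move=> null; apply: lebesgue_null_countable_cover => eps eps0.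
have nullN n : lebesgue_null (oapp N set0 (unpickle n)).
  by case: (unpickle n) => //=; exact: lebesgue_null0.
have epsn n : 0 < eps / 2 ^+ n.+1 by rewrite divr_gt0 ?exprn_gt0.
have /choice[l /choice[u luP]] n := nullN n _ (epsn n).
exists (nat * nat)%type, (fun p => l p.1 p.2), (fun p => u p.1 p.2); split.
- by move=> [n k] i; case: (luP n).
- move=> x [k _ Nkx]; have [_ [+ _]] := luP (pickle k).
  by rewrite pickleK /= => /(_ x Nkx)[j jx]; exists (pickle k, j).
- move=> s us; apply: sum_uniq_pair_le => //.
  + by move=> p; apply: box_vol_ge0; case: (luP p.1).
  + by move=> n m; case: (luP n) => _ [_].
  + exact: ltW.
Qed.

(* Covering by a grid of mesh [1/K] in the coordinates other than [i0], each
   column of the grid meets [N] in a set of height at most [2C/K]. *)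
Lemma lebesgue_null_lipschitz N (C : R) : 0 <= C ->
  (forall e, N e -> forall i, 0 <= e i <= 1) ->
  (forall e e' t, N e -> N e' -> (forall i, i != i0 -> `|e i - e' i| <= t) ->
     `|e i0 - e' i0| <= C * t) ->
  lebesgue_null N.
Proof.
move=> C0 cube lip; apply: lebesgue_null_countable_cover => eps eps0.
(* Chosen so that the total volume of the cover, [2C / K.+1], is at most [eps]. *)
pose K := Num.truncn (2 * C / eps).
have K0 : 0 < K.+1%:R :> R by [].
have Keps : 2 * C / K.+1%:R <= eps.
  rewrite ler_pdivrMr // [leRHS]mulrC -ler_pdivrMr //.
  exact/ltW/truncnS_gt.
pose cell (g : {ffun I -> 'I_K.+1}) z := N z /\
  forall i, i != i0 -> (g i)%:R / K.+1%:R <= z i <= (g i).+1%:R / K.+1%:R.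
(* A sample point of [N] in the column of [g]; the default 0 is taken only for columns that miss
   [N]. *)
pose z g := xget (fun=> 0) (cell g).
(* Coordinate [i0] is not subdivided: only [g] with [g i0 = ord0] carry a genuine box, and the
   others are degenerate in that coordinate. *)
pose l (g : {ffun I -> 'I_K.+1}) i := if i == i0 then
  if g i == ord0 then z g i - C / K.+1%:R else 0 else (g i)%:R / K.+1%:R.
pose u (g : {ffun I -> 'I_K.+1}) i := if i == i0 then
  if g i == ord0 then z g i + C / K.+1%:R else 0 else (g i).+1%:R / K.+1%:R.
pose F i (k : 'I_K.+1) : R := if i == i0 then
  if k == ord0 then 2 * C / K.+1%:R else 0 else 1 / K.+1%:R.
have ulE g i : u g i - l g i = F i (g i).
  rewrite /u /l /F; case: ifP => _; last first.
    by rewrite -mulrBl -[(g i).+1]addn1 natrD addrC addKr.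
  by case: ifP => _; [ring | rewrite subrr].
have F_ge0 i k : 0 <= F i k.
  rewrite /F; case: ifP => _; last exact: divr_ge0.
  by case: ifP => // _; rewrite divr_ge0 ?mulr_ge0.
exists {ffun I -> 'I_K.+1}, l, u; split.
- by move=> g i; rewrite -subr_ge0 ulE.
- move=> x Nx.
  (* The cap at [K] puts a coordinate equal to 1 in the last cell. *)
  pose g := [ffun i => if i == i0 then ord0 else
     inord (minn K (Num.truncn (x i * K.+1%:R))) : 'I_K.+1].
  have gx : cell g x.
    split=> // i /negbTE ii0; rewrite ffunE ii0 inordK ?ltnS ?geq_minl //.
    have /andP[x0 x1] := cube _ Nx i.
    have xK : 0 <= x i * K.+1%:R by rewrite mulr_ge0.
    rewrite ler_pdivrMr // ler_pdivlMr //; apply/andP; split.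
      have := truncn_le (x i * K.+1%:R); rewrite xK; apply: le_trans.
      by rewrite ler_nat geq_minr.
    rewrite /minn; case: ifP => _; last exact/ltW/truncnS_gt.
    by rewrite -[leRHS]mul1r ler_pM2r.
  have [Nz zP] : cell g (z g) by apply: (xgetPex _ (ex_intro _ x gx)).
  exists g => i; rewrite /l /u; case: eqP => [->|/eqP ii0];
    last by case: gx => _; apply.
  rewrite ffunE !eqxx -ler_distlC distrC.
  (* Off [i0], two points of one column differ by at most [1 / K.+1], so their heights differ by at
     most [C / K.+1]. *)
  have := lip x (z g) K.+1%:R^-1 Nx Nz; apply=> j ji0.
  have := zP j ji0; case: gx => _ /(_ j ji0).
  rewrite -[(g j).+1]addn1 natrD mulrDl mul1r.
  move: ((g j)%:R / K.+1%:R : R) (K.+1%:R^-1 : R) => p q.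
  by rewrite ler_norml; lra.
- move=> s us; apply: le_trans Keps.
  apply: (@le_trans _ _ (\sum_g box_vol (l g) (u g))).
    rewrite big_uniq //= big_mkcond; apply: ler_sum => g _.
    by case: ifP => // _; apply: prodr_ge0 => i _; rewrite ulE.
  have -> : \sum_g box_vol (l g) (u g) =
      \sum_(g : {ffun I -> 'I_K.+1}) \prod_i F i (g i).
    by apply: eq_bigr => g _; apply: eq_bigr => i _; rewrite ulE.
  (* The total volume factors into one sum per coordinate: [2C / K.+1] at [i0], and 1 elsewhere. *)
  rewrite -(bigA_distr_bigA F) (bigD1 i0) //=.
  have -> : \sum_j F i0 j = 2 * C / K.+1%:R.
    rewrite (bigD1 ord0) //= {1}/F !eqxx big1 ?addr0 // => k /negbTE k0.
    by rewrite /F eqxx k0.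
  rewrite (big1 _ _ (fun i => \sum_j F i j)) ?mulr1 // => i /negbTE ii0.
  by rewrite /F ii0 sumr_const card_ord -[LHS]mulr_natr mul1r mulVf // pnatr_eq0.
Qed.

End NullSets.

(** * Attainment of the payoffs *)

Section Continuity.
Variables (R : realType) (S : topologicalType).
Implicit Types F G : S -> R.

Lemma closed_le_continuous F G :
  continuous F -> continuous G -> closed [set z | F z <= G z].
Proof.
move=> cF cG.
have -> : [set z | F z <= G z] = (fun z => G z - F z) @^-1` [set x | 0 <= x].
  by apply/seteqP; split=> z /=; rewrite subr_ge0.
apply: (proj1 (continuous_closedP _)); last exact: closed_ge.
by move=> z; apply: (@continuousB R R S G F); [exact: cG | exact: cF].
Qed.

Lemma continuous_sumr (J : finType) (F : J -> S -> R) :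
  (forall j, continuous (F j)) -> continuous (fun z => \sum_j F j z).
Proof.
by move=> cF; apply: continuous_big => [|j _]; [exact: add_continuous | exact: cF].
Qed.

Lemma continuous_mulr F G :
  continuous F -> continuous G -> continuous (fun z => F z * G z).
Proof. by move=> cF cG z; apply: continuousM; [exact: cF | exact: cG]. Qed.

End Continuity.

Section Attainment.
Variables (R : realType) (T : finType).

(** A closed subset of the cube is compact by Tychonoff, so the extreme value theorem applies. *)
Lemma closed_unit_cube_max (K : set (T -> R)) (F : (T -> R) -> R) :
  closed K -> K !=set0 -> (forall z, K z -> forall t, 0 <= z t <= 1) ->
  continuous F -> exists2 z, K z & forall z', K z' -> F z' <= F z.
Proof.
move=> clK K0 cube cF.
have cK : compact K.
  apply: (@subclosed_compact _ _ [set z : T -> R | forall t, `[0, 1] (z t)]) => //.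
    by apply: (@tychonoff T (fun=> R) (fun=> `[0, 1])) => t; exact: segment_compact.
have [|z /set_mem Kz zmax] := @compact_EVT_max _ _ F _ K0 cK.
  exact: continuous_subspaceT.
by exists z => // z' Kz'; apply: zmax; apply/mem_set.
Qed.

End Attainment.

(** * Probability vectors and best replies *)

Section Distributions.
Variable R : realType.

Lemma is_dist_le1 (T : finType) (p : T -> R) t : is_dist p -> p t <= 1.
Proof.
move=> [p0 p1]; rewrite -p1 (bigD1 t) //= lerDl.
by apply: sumr_ge0.
Qed.

Lemma is_dist_pos (T : finType) (p : T -> R) : is_dist p -> exists t, 0 < p t.
Proof.
move=> [p0 p1]; apply: contrapT => /forallNP np.
have : \sum_t p t <= 0 by apply: sumr_le0 => t _; rewrite leNgt; apply/negP/np.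
by rewrite p1 leNgt ltr01.
Qed.

Lemma is_dist_eq1 (T : finType) (p : T -> R) t s :
  is_dist p -> p t = 1 -> p s = (s == t)%:R.
Proof.
move=> [p0 p1] pt; case: eqP => [->//|/eqP st].
have := p1; rewrite (bigD1 t) //= pt -[X in _ = X]addr0 => /addrI.
by move/psumr_eq0P => -> // r _.
Qed.

Lemma is_dist_dirac (T : finType) (t : T) : is_dist (fun s => (s == t)%:R : R).
Proof.
split=> [s|]; first exact: ler0n.
by rewrite (bigD1 t) //= eqxx big1 ?addr0 // => s /negbTE ->.
Qed.

Lemma sum_dirac (T : finType) (t : T) (F : T -> R) :
  \sum_s (s == t)%:R * F s = F t.
Proof.
rewrite (bigD1 t) //= eqxx mul1r big1 ?addr0 // => s /negbTE ->.
exact: mul0r.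
Qed.

Lemma is_dist_mean_const (T : finType) (p F : T -> R) (c : R) :
  is_dist p -> (forall t, 0 < p t -> F t = c) -> \sum_t p t * F t = c.
Proof.
move=> [p0 p1] Fc; rewrite -[RHS]mul1r -p1 mulr_suml; apply: eq_bigr => t _.
have := p0 t; rewrite le_eqVlt => /orP[/eqP <-|/Fc ->//].
by rewrite !mul0r.
Qed.

(** The objective separates over [i], so optimality means that each [p i] is supported on maximizers
    of [F i]. This serves both players. *)
Lemma best_replyP (I T : finType) (p F : I -> T -> R) :
  (forall i, is_dist (p i)) ->
  (forall p', (forall i, is_dist (p' i)) ->
     \sum_i \sum_t p' i t * F i t <= \sum_i \sum_t p i t * F i t) <->
  (forall i t t', 0 < p i t -> F i t' <= F i t).
Proof.
move=> dp; split=> [opt i t t' pt|opt p' dp'].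
  rewrite leNgt; apply/negP => Flt.
  (* The deviation that moves all the mass of [t] to [t'] in row [i]. *)
  pose d j s : R := (j == i)%:R * p i t * ((s == t')%:R - (s == t)%:R).
  have dE (G : T -> R) j :
      \sum_s d j s * G s = (j == i)%:R * p i t * (G t' - G t).
    rewrite -(sum_dirac t' G) -(sum_dirac t G) -sumrB mulr_sumr.
    by apply: eq_bigr => s _; rewrite /d; ring.
  have dp' j : is_dist (fun s => p j s + d j s).
    have [p0 p1] := dp j; split=> [s|].
      rewrite /d; case: (eqVneq j i) => [->|_]; last by rewrite !mul0r addr0.
      rewrite mul1r; case: (eqVneq s t) => [->|_].
        by rewrite mulrBr mulr1 addrC subrK mulr_ge0 ?ler0n ?(ltW pt).
      by rewrite subr0 addr_ge0 ?mulr_ge0 ?ler0n ?(ltW pt) //; case: (dp i).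
    rewrite big_split /= p1 -[RHS]addr0; congr (_ + _).
    have := dE (fun=> 1) j; rewrite subrr mulr0 => dE0; rewrite -[RHS]dE0.
    by apply: eq_bigr => s _; rewrite mulr1.
  have := opt _ dp'.
  have -> : \sum_j \sum_s (p j s + d j s) * F j s =
     \sum_j \sum_s p j s * F j s + p i t * (F i t' - F i t).
    transitivity (\sum_j (\sum_s p j s * F j s + \sum_s d j s * F j s)).
      apply: eq_bigr => j _; rewrite -big_split.
      by apply: eq_bigr => s _; rewrite mulrDl.
    rewrite big_split; congr (_ + _).
    under eq_bigr do rewrite dE -mulrA.
    by rewrite sum_dirac.
  by rewrite gerDl leNgt mulr_gt0 // subr_gt0.
apply: ler_sum => i _.
have [t0 pt0] := is_dist_pos (dp i).
rewrite [leRHS](is_dist_mean_const (c := F i t0)) //; last first.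
  by move=> t pt; apply: le_anti; rewrite !opt.
have [p'0 p'1] := dp' i; rewrite -[leRHS]mul1r -p'1 mulr_suml.
by apply: ler_sum => t _; apply: ler_wpM2l => //; apply: opt.
Qed.

End Distributions.

(** * Payoffs, compactness of the sets of profiles, and babbling *)

Section Profiles.
Variables (R : realType) (A Omega M : finType) (mu0 : Omega -> R).
Implicit Types (u : A -> Omega -> R) (sigma : Omega -> M -> R) (rho : M -> A -> R).

(** Not divided by the probability of [m], so off-path messages simply have value 0. *)
Definition message_value u sigma m a : R :=
  \sum_w mu0 w * sigma w m * u a w.
Definition reply_value u rho w m : R := \sum_a rho m a * u a w.

Lemma payoff_message_value u sigma rho :
  payoff mu0 u sigma rho = \sum_m \sum_a rho m a * message_value u sigma m a.
Proof.
rewrite /payoff exchange_big; apply: eq_bigr => m _.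
rewrite exchange_big; apply: eq_bigr => a _.
by rewrite mulr_sumr; apply: eq_bigr => w _; ring.
Qed.

Lemma payoff_reply_value u sigma rho :
  payoff mu0 u sigma rho =
  \sum_w \sum_m sigma w m * (mu0 w * reply_value u rho w m).
Proof.
apply: eq_bigr => w _; apply: eq_bigr => m _.
by rewrite !mulr_sumr; apply: eq_bigr => a _; ring.
Qed.

Lemma R_BR_message_value uR sigma rho : action_strat rho ->
  R_BR mu0 uR sigma rho <->
  (forall m a a', 0 < rho m a ->
     message_value uR sigma m a' <= message_value uR sigma m a).
Proof.
move=> drho; rewrite -(best_replyP (message_value uR sigma) drho).
split=> H rho' /H; by rewrite !payoff_message_value.
Qed.

Lemma S_BR_reply_value uS sigma rho : (forall w, 0 < mu0 w) -> messaging sigma ->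
  S_BR mu0 uS sigma rho <->
  (forall w m m', 0 < sigma w m ->
     reply_value uS rho w m' <= reply_value uS rho w m).
Proof.
move=> mu0_gt0 dsig.
transitivity (forall w m m', 0 < sigma w m ->
    mu0 w * reply_value uS rho w m' <= mu0 w * reply_value uS rho w m).
  rewrite -(best_replyP (fun w m => mu0 w * reply_value uS rho w m) dsig).
  split=> H s' /H; by rewrite !payoff_reply_value.
by split=> H w m m' /(H w m m'); rewrite ler_pM2l.
Qed.

(** Rewrites the existential condition as polynomial inequalities, which visibly define a closed
    set. *)
Lemma partitional_sqr sigma : messaging sigma ->
  partitional sigma <-> (forall w m, sigma w m <= sigma w m * sigma w m).
Proof.
move=> dsig; split=> [part w m|sq w].
  have [m0 m01] := part w.
  by rewrite (is_dist_eq1 m (dsig w) m01); case: eqP; rewrite ?mulr1 ?mulr0.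
have [m mp] := is_dist_pos (dsig w); exists m.
have := sq w m; rewrite -[leLHS]mulr1 ler_pM2l // => le1.
by apply: le_anti; rewrite le1 is_dist_le1.
Qed.

(** A profile becomes a single vector, so that compactness of one cube suffices. *)
Definition profile_space := (Omega * M + M * A)%type.
Definition profile_sigma (z : profile_space -> R) w m := z (inl (w, m)).
Definition profile_rho (z : profile_space -> R) m a := z (inr (m, a)).

Lemma continuous_coord (T : finType) (t : T) : continuous (fun z : T -> R => z t).
Proof. exact: (@proj_continuous T (fun=> R) t). Qed.

Lemma continuous_payoff_comp (S : topologicalType) u
    (sg : S -> Omega -> M -> R) (rh : S -> M -> A -> R) :
  (forall w m, continuous (fun z => sg z w m)) ->
  (forall m a, continuous (fun z => rh z m a)) ->
  continuous (fun z => payoff mu0 u (sg z) (rh z)).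
Proof.
move=> csg crh.
have cc (c : R) : continuous (fun _ : S => c) by exact: cst_continuous.
apply: continuous_sumr => w; apply: continuous_sumr => m.
apply: continuous_sumr => a; apply: continuous_mulr; last exact: cc.
apply: continuous_mulr; last exact: crh.
by apply: continuous_mulr; [exact: cc | exact: csg].
Qed.

Lemma continuous_payoff u : continuous
  (fun z => payoff mu0 u (profile_sigma z) (profile_rho z)).
Proof. by apply: continuous_payoff_comp => *; exact: continuous_coord. Qed.

Lemma continuous_payoff_sigma u sigma : continuous
  (fun z => payoff mu0 u sigma (profile_rho z)).
Proof.
apply: continuous_payoff_comp => *; last exact: continuous_coord.
exact: cst_continuous.
Qed.

Lemma continuous_payoff_rho u rho : continuous
  (fun z => payoff mu0 u (profile_sigma z) rho).
Proof.
apply: continuous_payoff_comp => *; first exact: continuous_coord.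
exact: cst_continuous.
Qed.

Lemma closed_forall (S : topologicalType) (J : Type) (P : J -> S -> Prop) :
  (forall j, closed [set z | P j z]) -> closed [set z | forall j, P j z].
Proof.
move=> cl; have -> : [set z | forall j, P j z] = \bigcap_j [set z | P j z].
  by apply/seteqP; split=> [z H j _|z H j]; [exact: H | exact: (H j I)].
by apply: closed_bigI => j _; exact: cl.
Qed.

Lemma closed_imply (S : topologicalType) (Q : Prop) (P : S -> Prop) :
  closed [set z | P z] -> closed [set z | Q -> P z].
Proof.
move=> cl; have [q|nq] := pselect Q.
  by have -> : [set z | Q -> P z] = [set z | P z] by apply/seteqP; split=> z /=; auto.
have -> : [set z | Q -> P z] = setT by apply/seteqP; split=> // z _ /nq.
exact: closedT.
Qed.

Lemma closed_is_dist (S : topologicalType) (T : finType) (p : T -> S -> R) :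
  (forall t, continuous (p t)) -> closed [set z | is_dist (p^~ z)].
Proof.
move=> cp; have cc (c : R) : continuous (fun _ : S => c) by exact: cst_continuous.
have -> : [set z | is_dist (p^~ z)] = [set z | forall t, 0 <= p t z] `&`
    ([set z | \sum_t p t z <= 1] `&` [set z | 1 <= \sum_t p t z]).
  apply/seteqP; split=> z; first by case=> p0 p1; rewrite /= p1.
  by case=> p0 [le1 ge1]; split=> //; apply: le_anti; rewrite le1.
apply: closedI; first by apply: closed_forall => t; exact: closed_le_continuous.
by apply: closedI; apply: closed_le_continuous => //; exact: continuous_sumr.
Qed.

Lemma closed_persuasion_profile uR : closed
  [set z | persuasion_profile mu0 uR (profile_sigma z) (profile_rho z)].
Proof.
apply: closedI.
  apply: closed_forall => w.
  apply: (@closed_is_dist _ _ (fun m z => profile_sigma z w m)) => m.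
  exact: continuous_coord.
apply: closedI.
  apply: closed_forall => m.
  apply: (@closed_is_dist _ _ (fun a z => profile_rho z m a)) => a.
  exact: continuous_coord.
apply: closed_forall => rho; apply: closed_imply; apply: closed_le_continuous.
  exact: continuous_payoff_rho.
exact: continuous_payoff.
Qed.

Lemma closed_S_BR uS : closed
  [set z | S_BR mu0 uS (profile_sigma z) (profile_rho z)].
Proof.
apply: closed_forall => sigma; apply: closed_imply; apply: closed_le_continuous.
  exact: continuous_payoff_sigma.
exact: continuous_payoff.
Qed.

Lemma profile_max uS uR (P : (Omega -> M -> R) -> (M -> A -> R) -> Prop) :
  (forall sigma rho, P sigma rho -> persuasion_profile mu0 uR sigma rho) ->
  closed [set z | P (profile_sigma z) (profile_rho z)] ->
  (exists sigma rho, P sigma rho) ->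
  exists sigma rho, P sigma rho /\
    forall sigma' rho', P sigma' rho' ->
      payoff mu0 uS sigma' rho' <= payoff mu0 uS sigma rho.
Proof.
move=> sub cl [sigma0 [rho0 P0]].
pose z0 sigma rho (t : profile_space) : R :=
  match t with inl p => sigma p.1 p.2 | inr p => rho p.1 p.2 end.
have [||z Pz zmax] := closed_unit_cube_max cl _ _ (@continuous_payoff uS).
- by exists (z0 sigma0 rho0).
- move=> z /sub[ds [dr _]] [[w m]|[m a]].
    by have [p0 _] := ds w; rewrite p0 (is_dist_le1 m (ds w)).
  by have [p0 _] := dr m; rewrite p0 (is_dist_le1 a (dr m)).
exists (profile_sigma z), (profile_rho z); split=> // s r Psr.
exact: (zmax (z0 s r)).
Qed.

(** Sender always sends [m0] and Receiver always plays an action optimal under the prior. This makes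
    all three sets of profiles nonempty. *)
Lemma babbling uS uR : (0 < #|A|)%N -> (0 < #|M|)%N ->
  exists sigma rho, cheap_talk_eq mu0 uS uR sigma rho /\ partitional sigma.
Proof.
move=> /card_gt0P[a1 _] /card_gt0P[m0 _].
pose g a : R := \sum_w mu0 w * uR a w.
pose a0 := [arg max_(a > a1) g a]%O.
have a0P a : g a <= g a0 by rewrite /a0; case: arg_maxP => // i _; apply.
pose sigma (w : Omega) m : R := (m == m0)%:R.
pose rho (m : M) a : R := (a == a0)%:R.
exists sigma, rho.
have drho : action_strat rho by move=> m; exact: is_dist_dirac.
split; last by move=> w; exists m0; rewrite /sigma eqxx.
split; first by move=> w; exact: is_dist_dirac.
split=> //; split.
  move=> sigma' dsig'; rewrite !payoff_reply_value; apply: ler_sum => w _.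
  have E m : mu0 w * reply_value uS rho w m = mu0 w * uS a0 w.
    by rewrite /reply_value sum_dirac.
  rewrite !(is_dist_mean_const (c := mu0 w * uS a0 w)) //.
  exact: is_dist_dirac.
apply/R_BR_message_value => // m a a'; rewrite /rho; case: eqP => [-> _|_]; last first.
  by rewrite ltxx.
have E b : message_value uR sigma m b = (m == m0)%:R * g b.
  by rewrite /message_value /g mulr_sumr; apply: eq_bigr => w _; rewrite /sigma; ring.
by rewrite !E ler_wpM2l.
Qed.

(** * Absence of a payoff gap as existence of an optimal profile in the smaller class *)

Definition persuasion_optimal uS uR sigma rho := forall sigma' rho',
  persuasion_profile mu0 uR sigma' rho' ->
  payoff mu0 uS sigma' rho' <= payoff mu0 uS sigma rho.

Lemma sup_max (X : set R) x : X x -> (forall y, X y -> y <= x) -> sup X = x.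
Proof.
move=> Xx Xub; apply: le_anti; rewrite ge_sup //=; last by exists x.
by apply: ub_le_sup => //; exists x.
Qed.

(** Both suprema are attained; without a gap, the best profile in [P] is therefore optimal among all
    persuasion profiles. *)
Lemma payoff_sup_lt uS uR (P : (Omega -> M -> R) -> (M -> A -> R) -> Prop) :
  (forall sigma rho, P sigma rho -> persuasion_profile mu0 uR sigma rho) ->
  closed [set z | P (profile_sigma z) (profile_rho z)] ->
  (exists sigma rho, P sigma rho) ->
  ~ (sup [set x | exists sigma rho, P sigma rho /\ x = payoff mu0 uS sigma rho]
     < persuasion_payoff M mu0 uS uR) <->
  exists sigma rho, P sigma rho /\ persuasion_optimal uS uR sigma rho.
Proof.
move=> sub cl ex.
have [s [r [Psr srmax]]] := profile_max uS sub cl ex.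
have [] := @profile_max uS uR _ (fun _ _ => id) (@closed_persuasion_profile uR).
  by exists s, r; exact: sub.
move=> s' [r' [Psr' sr'max]].
rewrite (@sup_max _ (payoff mu0 uS s r)); [|by exists s, r|]; last first.
  by move=> _ [? [? [? ->]]]; exact: srmax.
rewrite /persuasion_payoff (@sup_max _ (payoff mu0 uS s' r'));
  [|by exists s', r'|]; last first.
  by move=> _ [? [? [? ->]]]; exact: sr'max.
split=> [/negP|[s1 [r1 [P1 opt1]]]].
  rewrite -leNgt => le; exists s, r; split=> // s2 r2 /sr'max /le_trans; exact.
by apply/negP; rewrite -leNgt (le_trans (opt1 _ _ Psr')) // srmax.
Qed.

Lemma not_commitment_valuable uS uR : (0 < #|A|)%N -> (0 < #|M|)%N ->
  ~ commitment_valuable M mu0 uS uR <->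
  exists sigma rho, cheap_talk_eq mu0 uS uR sigma rho /\
    persuasion_optimal uS uR sigma rho.
Proof.
move=> A0 M0; apply: payoff_sup_lt.
- by move=> s r [? [? [? ?]]].
- have -> : [set z | cheap_talk_eq mu0 uS uR (profile_sigma z) (profile_rho z)] =
      [set z | persuasion_profile mu0 uR (profile_sigma z) (profile_rho z)] `&`
      [set z | S_BR mu0 uS (profile_sigma z) (profile_rho z)].
    apply/seteqP; split=> z; first by case=> ? [? [? ?]]; split=> //; split.
    by case=> -[? [? ?]] ?; split=> //; split.
  by apply: closedI; [exact: closed_persuasion_profile | exact: closed_S_BR].
- by have [s [r [ct _]]] := babbling uS uR A0 M0; exists s, r.
Qed.

Lemma not_values_randomization uS uR : (0 < #|A|)%N -> (0 < #|M|)%N ->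
  ~ values_randomization M mu0 uS uR <->
  exists sigma rho, (persuasion_profile mu0 uR sigma rho /\ partitional sigma) /\
    persuasion_optimal uS uR sigma rho.
Proof.
move=> A0 M0; rewrite -payoff_sup_lt.
- rewrite /values_randomization /partitional_persuasion_payoff.
  have -> // : [set x | exists sigma rho, persuasion_profile mu0 uR sigma rho /\
      partitional sigma /\ x = payoff mu0 uS sigma rho] =
    [set x | exists sigma rho, (persuasion_profile mu0 uR sigma rho /\
      partitional sigma) /\ x = payoff mu0 uS sigma rho].
  by apply/seteqP; split=> x [s [r]]; [case=> ? [? ?] | case=> -[? ?] ?]; exists s, r.
- by move=> s r [].
- have -> : [set z | persuasion_profile mu0 uR (profile_sigma z) (profile_rho z) /\
         partitional (profile_sigma z)] =
      [set z | persuasion_profile mu0 uR (profile_sigma z) (profile_rho z)] `&`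
      [set z | forall p : Omega * M, z (inl p) <= z (inl p) * z (inl p)].
    apply/seteqP; split=> z /= [pz H]; split=> //; case: (pz) => dz _.
      by move=> [w m]; apply: (proj1 (partitional_sqr dz)).
    by apply/(partitional_sqr dz) => w m; apply: (H (w, m)).
  apply: closedI; first exact: closed_persuasion_profile.
  apply: closed_forall => p; apply: closed_le_continuous.
    exact: continuous_coord.
  by apply: continuous_mulr; exact: continuous_coord.
- have [s [r [[? [? [_ ?]]] ?]]] := babbling uR uR A0 M0; exists s, r.
  by split.
Qed.

End Profiles.

(** * Vertices and linear systems *)

Section LinearSystems.
Variables (R : realType) (T J : finType) (c : J -> T -> R).

Definition lin (x : T -> R) j : R := \sum_t c j t * x t.

Lemma linDZ x y (a : R) j : lin (fun t => x t + a * y t) j = lin x j + a * lin y j.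
Proof.
rewrite /lin mulr_sumr -big_split; apply: eq_bigr => t _ /=; ring.
Qed.

(* Any feasible point can be pushed along directions that keep the tight
   constraints tight until it is a vertex, i.e. determined by them. *)
Lemma exists_vertex (D : (T -> R) -> Prop) (x0 : T -> R) :
  D (fun=> 0) ->
  (forall x y (a : R), D x -> D y -> D (fun t => x t + a * y t)) ->
  (forall d, D d -> (forall j, 0 <= lin d j) -> forall t, d t = 0) ->
  (forall j, 0 <= lin x0 j) ->
  exists d (x := fun t => x0 t + d t), [/\ D d, forall j, 0 <= lin x j,
    forall j, lin x0 j = 0 -> lin x j = 0 &
    forall d', D d' -> (forall j, lin x j = 0 -> lin d' j = 0) -> forall t, d' t = 0].
Proof.
(* Induction on the number of slack constraints at [x0]. *)
move=> D0 DD Dbnd; have [n] := ubnP #|[pred j | lin x0 j != 0]|.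
elim: n x0 => // n IH x0; rewrite ltnS => len x00.
have [vert|] := pselect (forall d, D d ->
   (forall j, lin x0 j = 0 -> lin d j = 0) -> forall t, d t = 0).
  exists (fun=> 0).
  by have -> : (fun t => x0 t + 0) = x0 by apply: funext => t; rewrite addr0.
move=> /existsNP[d /not_implyP[Dd /not_implyP[d0 /existsNP[t0 dt0]]]].
have [j1 dj1] : exists j, lin d j < 0.
  apply: contrapT => /forallNP dge; apply: dt0; apply: Dbnd => // j.
  by rewrite leNgt; apply/negP/dge.
(* Ratio test: [r j] is the step length at which a decreasing constraint becomes tight. The smallest
   one preserves feasibility and makes the slack constraint [js] tight. *)
pose r j := lin x0 j / - lin d j.
have [js djs rmin] := @Order.TotalTheory.arg_minP _ R J j1 (fun j => lin d j < 0) r dj1.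
have r0 : 0 <= r js by rewrite divr_ge0 // oppr_ge0 ltW.
pose x1 t := x0 t + r js * d t.
have x1E j : lin x1 j = lin x0 j + r js * lin d j by exact: linDZ.
have x1_ge0 j : 0 <= lin x1 j.
  rewrite x1E; have [dj|dj] := leP 0 (lin d j);
    first by rewrite addr_ge0 ?(mulr_ge0 r0).
  have := rmin j dj; rewrite ler_pdivlMr ?oppr_gt0 // mulrN.
  by rewrite -subr_ge0 opprK.
have keep j : lin x0 j = 0 -> lin x1 j = 0.
  by move=> xj; rewrite x1E xj d0 // mulr0 addr0.
have x1js : lin x1 js = 0.
  by rewrite x1E /r invrN mulrN mulNr divfK ?subrr // lt_eqF.
have card1 : (#|[pred j | lin x1 j != 0%R]| < n)%N.
  apply: leq_trans len; apply: proper_card; apply/properP; split.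
    by apply/fintype.subsetP => j; rewrite !inE; apply: contra_neq; exact: keep.
  exists js; rewrite !inE ?x1js ?eqxx //.
  by apply/eqP => /d0 dj0; rewrite dj0 ltxx in djs.
have [d1 [Dd1 ge1 act1 vert1]] := IH x1 card1 x1_ge0.
exists (fun t => d1 t + r js * d t).
have -> : (fun t => x0 t + (d1 t + r js * d t)) = (fun t => x1 t + d1 t).
  by apply: funext => t; rewrite /x1 -addrA (addrC (d1 t)).
by split=> //; [exact: DD | move=> j /keep/act1].
Qed.

(** An injective linear map has a left inverse. Bounds on the entries of [B] later control how
    solutions vary with the coefficients. *)
Lemma lin_left_inverse : (forall x, (forall j, lin x j = 0) -> forall t, x t = 0) ->
  exists B : T -> J -> R, forall x t, x t = \sum_j B t j * lin x j.
Proof.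
move=> inj.
pose L : 'M[R]_(#|T|, #|J|) := \matrix_(i, j) c (enum_val j) (enum_val i).
have sumE (K : finType) (F : K -> R) : \sum_(i < #|K|) F (enum_val i) = \sum_k F k.
  by rewrite [RHS](reindex (@enum_val K predT)) //; exact/onW_bij/enum_val_bij.
have mulL (v : 'rV[R]_#|T|) j :
    (v *m L) 0 j = lin (fun t => v 0 (enum_rank t)) (enum_val j).
  rewrite mxE /lin -[RHS]sumE; apply: eq_bigr => i _.
  by rewrite mxE enum_valK mulrC.
have /row_freeP[B LB] : row_free L.
  rewrite -kermx_eq0; apply/rowV0P => v /sub_kermxP vL.
  apply/rowP => i; rewrite mxE -(enum_valK i).
  apply: (inj (fun t => v 0 (enum_rank t))) => j.
  by rewrite -(enum_rankK j) -mulL vL mxE.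
exists (fun t j => B (enum_rank j) (enum_rank t)) => x t.
pose v : 'rV[R]_#|T| := \row_i x (enum_val i).
have vx : (fun t => v 0 (enum_rank t)) = x.
  by apply: funext => s; rewrite mxE enum_rankK.
rewrite -{1}vx -[v]mulmx1 -LB mulmxA mxE -[RHS]sumE; apply: eq_bigr => j _.
by rewrite mulL vx enum_valK mulrC.
Qed.

End LinearSystems.

(** * Generic environments *)

Section Genericity.
Variables (R : realType) (A Omega M : finType) (mu0 : Omega -> R).
Hypotheses (mu0_gt0 : forall w, 0 < mu0 w) (mu0_sum : \sum_w mu0 w = 1).

Local Notation env := ((bool * A * Omega)%type -> R).
Local Notation cube := [set e : env | forall i, 0 <= e i <= 1].

Lemma mu0_le1 w : mu0 w <= 1.
Proof. by apply: is_dist_le1; split=> // v; exact: ltW. Qed.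

Lemma ler_norm_sum_card (K : finType) (P : pred K) (F : K -> R) (c : R) :
  0 <= c -> (forall k, `|F k| <= c) -> `|\sum_(k | P k) F k| <= #|K|%:R * c.
Proof.
move=> c0 Fc; apply: le_trans (ler_norm_sum _ _ _) _.
rewrite mulr_natl -sumr_const big_mkcond; apply: ler_sum => k _.
by case: ifP.
Qed.

(* Solving the equation for the coordinate [(b, a, w0)] exhibits the set as a
   Lipschitz graph over the remaining coordinates. *)
Lemma indifference_null b a a' w0 (Y : env -> (Omega -> R) -> Prop) (L kappa : R) :
  a != a' -> 0 < kappa -> 0 <= L ->
  (forall e y, Y e y -> [/\ cube e, forall w, `|y w| <= 1, kappa <= `|y w0| &
     \sum_w y w * (e (b, a, w) - e (b, a', w)) = 0]) ->
  (forall e e' y y' s, Y e y -> Y e' y' ->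
     (forall i, i != (b, a, w0) -> `|e i - e' i| <= s) ->
     forall w, `|y w - y' w| <= L * s) ->
  lebesgue_null [set e | exists y, Y e y].
Proof.
move=> aa' k0 L0 HY lipY.
have n0 : 0 <= #|Omega|%:R :> R by [].
apply: (@lebesgue_null_lipschitz _ _ (b, a, w0) _
  (1 + (#|Omega|%:R * 2 + #|Omega|%:R * L) / kappa)).
- by rewrite addr_ge0 // divr_ge0 ?addr_ge0 ?mulr_ge0 // ltW.
- by move=> e [y /HY[]].
move=> e e' s [y Yy] [y' Yy'] close.
have [ce y1 ky ysum] := HY _ _ Yy; have [ce' y'1 _ y'sum] := HY _ _ Yy'.
have ne_a' w : (b, a', w) != (b, a, w0).
  by apply/eqP => -[/eqP]; rewrite eq_sym (negbTE aa').
have s0 : 0 <= s by apply: le_trans (close _ (ne_a' w0)).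
pose D w := e (b, a, w) - e (b, a', w); pose D' w := e' (b, a, w) - e' (b, a', w).
have D'1 w : `|D' w| <= 1.
  by move: (ce' (b, a, w)) (ce' (b, a', w)); rewrite /D' ler_norml; lra.
have DD' w : w != w0 -> `|D w - D' w| <= 2 * s.
  move=> ww0; have := close _ (ne_a' w).
  have /close : (b, a, w) != (b, a, w0) by apply: contra_neq ww0 => -[].
  by rewrite /D /D' !ler_norml; lra.
(* The difference of the two indifference equations, solved for the term at [w0]. *)
have E : y w0 * (D w0 - D' w0) =
   - (\sum_(w | w != w0) y w * (D w - D' w)) - \sum_w (y w - y' w) * D' w.
  have : \sum_w y w * (D w - D' w) + \sum_w (y w - y' w) * D' w = 0.
    transitivity (\sum_w y w * D w - \sum_w y' w * D' w); last first.
      by rewrite ysum y'sum subrr.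
    rewrite -big_split -sumrB.
    by apply: eq_bigr => w _; rewrite /D /D' /=; ring.
  by rewrite (bigD1 w0) //=; move: (\sum_(w | w != w0) _) (\sum_w _) => p q; lra.
have D0 : `|D w0 - D' w0| <= (#|Omega|%:R * 2 + #|Omega|%:R * L) / kappa * s.
  rewrite mulrAC ler_pdivlMr //.
  apply: (@le_trans _ _ (`|y w0 * (D w0 - D' w0)|)).
    by rewrite normrM mulrC ler_wpM2r.
  rewrite E -opprD normrN; apply: le_trans (ler_normD _ _) _.
  rewrite mulrDl -!mulrA; apply: lerD.
    rewrite big_mkcond; apply: ler_norm_sum_card => [|w]; first exact: mulr_ge0.
    case: ifP => [ww0|_]; last by rewrite normr0 mulr_ge0.
    rewrite normrM; apply: le_trans (DD' _ ww0).
    by rewrite -[leRHS]mul1r ler_wpM2r.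
  apply: ler_norm_sum_card => [|w]; first exact: mulr_ge0.
  rewrite normrM; apply: le_trans (lipY _ _ _ _ _ Yy Yy' close w).
  by rewrite -[leRHS]mulr1 ler_wpM2l.
have := close _ (ne_a' w0); move: D0.
rewrite [_ * s in X in _ -> _ -> X]mulrDl mul1r /D /D'.
by move: (_ / kappa * s) => q; rewrite !ler_norml; lra.
Qed.

(** The case of constant coefficients, with Lipschitz constant 0. *)
Lemma hyperplane_null b a a' (c : Omega -> R) w0 :
  a != a' -> c w0 != 0 -> (forall w, `|c w| <= 1) ->
  lebesgue_null [set e : env | cube e /\
     \sum_w c w * (e (b, a, w) - e (b, a', w)) = 0].
Proof.
move=> aa' cw0 c1.
apply: (@lebesgue_null_sub _ _ _ [set e | exists y, [/\ y = c, cube e &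
   \sum_w y w * (e (b, a, w) - e (b, a', w)) = 0]]).
  by move=> e [ce eq0]; exists c.
apply: (@indifference_null b a a' w0 _ 0 `|c w0|) => //; first by rewrite normr_gt0.
  by move=> e y [-> ce eq0].
by move=> e e' y y' s [-> _ _] [-> _ _] _ w; rewrite subrr normr0 mul0r.
Qed.

(** The equations of a vertex: zero entries in [Z], total mass in each state, and Receiver
    indifferences in [E]. Rows outside [Z] and [E] vanish, so all systems share one index type. *)
Definition system (Z : {set Omega * M}) (E : {set M * A * A}) (e : env)
    (j : Omega * M + Omega + M * A * A) (p : Omega * M) : R :=
  match j with
  | inl (inl q) => if q \in Z then (p == q)%:R else 0
  | inl (inr w) => (p.1 == w)%:R
  | inr q => if q \in E then
      (p.2 == q.1.1)%:R * (mu0 p.1 * (e (false, q.1.2, p.1) - e (false, q.2, p.1)))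
      else 0
  end.

Definition system_rhs (j : Omega * M + Omega + M * A * A) : R :=
  if j is inl (inr w) then 1 else 0.

Lemma system_lipschitz Z E (e e' : env) s j p :
  (forall a w, `|e (false, a, w) - e' (false, a, w)| <= s) -> 0 <= s ->
  `|system Z E e j p - system Z E e' j p| <= 2 * s.
Proof.
move=> close s0; have s2 : 0 <= 2 * s by exact: mulr_ge0.
case: j => [[q|w]|[[m a] a']] /=; rewrite ?subrr ?normr0 //.
case: ifP => _; last by rewrite subrr normr0.
rewrite -mulrBr normrM -[leRHS]mul1r; apply: ler_pM => //.
  by case: eqP; rewrite ?normr1 ?normr0.
rewrite -mulrBr normrM -[leRHS]mul1r; apply: ler_pM => //.
  by rewrite ger0_norm ?mu0_le1 // ltW.
by move: (close a p.1) (close a' p.1); rewrite !ler_norml; lra.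
Qed.

Definition system_inj Z E e := forall x,
  (forall j, lin (system Z E e) x j = 0) -> forall t, x t = 0.

(** At the vertex determined by [Z] and [E], state [w0] sends [m] while Sender is indifferent
    between [a] and [a'] given [m]. *)
Definition vertex_bad Z E m a a' w0 : set env := [set e | [/\ cube e, a != a',
  system_inj Z E e & exists x, [/\ forall p, 0 <= x p <= 1,
    forall j, lin (system Z E e) x j = system_rhs j,
    x (w0, m) != 0 &
    \sum_w mu0 w * x (w, m) * (e (true, a, w) - e (true, a', w)) = 0]]].

(* A left inverse of the system with entries at most [n] makes its solution a
   Lipschitz function of the receiver's utilities. *)
Lemma vertex_bad_null Z E m a a' w0 : lebesgue_null (vertex_bad Z E m a a' w0).
Proof.
have [->|aa'] := eqVneq a a'.
  apply: lebesgue_null_sub (@lebesgue_null0 R _ (true, a', w0)) => e [_].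
  by rewrite eqxx.
(* Stratum [n] also keeps the coefficient at [w0] away from 0, which supplies [kappa] in
   [indifference_null]. *)
pose Y (n : nat) (e : env) (y : Omega -> R) := exists x B,
  [/\ cube e, forall p, 0 <= x p <= 1,
    forall j, lin (system Z E e) x j = system_rhs j &
  [/\ forall x' t, x' t = \sum_j B t j * lin (system Z E e) x' j,
    forall t j, `|B t j| <= n.+1%:R :> R,
    y = (fun w => mu0 w * x (w, m)),
    n.+1%:R^-1 <= `|y w0| &
    \sum_w y w * (e (true, a, w) - e (true, a', w)) = 0]].
apply: (@lebesgue_null_sub _ _ _ (\bigcup_n [set e | exists y, Y n e y])).
  move=> e [ce _ inj [x [x01 xsol xw0 xind]]].
  have [B BP] := lin_left_inverse inj.
  pose y w := mu0 w * x (w, m).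
  have yw0 : 0 < `|y w0| by rewrite normr_gt0 mulf_neq0 // gt_eqF.
  pose r := \sum_t \sum_j `|B t j| + `|y w0|^-1.
  exists (Num.truncn r) => //.
  have rlt : r <= (Num.truncn r).+1%:R by exact/ltW/truncnS_gt.
  have sumB : 0 <= \sum_t \sum_j `|B t j| by do 2!apply: sumr_ge0 => ? _.
  exists y, x, B; split=> //; split=> //.
    move=> t j; apply: le_trans rlt; rewrite /r (bigD1 t) //= (bigD1 j) //= -!addrA.
    rewrite lerDl !addr_ge0 ?invr_ge0 //; first exact: sumr_ge0.
    by apply: sumr_ge0 => ? _; apply: sumr_ge0.
  rewrite -[leRHS]invrK lef_pV2 ?posrE ?invr_gt0 //.
  by apply: le_trans rlt; rewrite lerDr.
apply: (lebesgue_null_bigcup (true, a, w0)) => n.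
apply: (@indifference_null true a a' w0 (Y n)
  (#|{: Omega * M + Omega + M * A * A}|%:R *
     (n.+1%:R * (#|{: Omega * M}|%:R * 2))) n.+1%:R^-1) => //.
- by rewrite invr_gt0.
- by rewrite !mulr_ge0.
- move=> e y [x [B [ce x01 xsol [_ _ -> yw0 ysum]]]]; split=> // w.
  have /andP[x0 x1] := x01 (w, m).
  rewrite ger0_norm ?mulr_ge0 ?(ltW (mu0_gt0 w)) // -[leRHS]mulr1.
  by rewrite ler_pM ?(ltW (mu0_gt0 w)) ?mu0_le1.
move=> e e' y y' s [x [B [ce x01 xsol [BP Bn -> _ _]]]].
move=> [x' [B' [ce' x'01 x'sol [_ _ -> _ _]]]] close w.
have s0 : 0 <= s.
  apply: le_trans (close (true, a', w0) _) => //.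
  by apply/eqP => -[/eqP]; rewrite eq_sym (negbTE aa').
(* Both solutions have the same right-hand side, so the system of [e] maps [x - x'] to the
   difference of the two systems applied to [x']. *)
have sysd j : `|lin (system Z E e) (fun p => x p + -1 * x' p) j| <=
    #|{: Omega * M}|%:R * (2 * s).
  rewrite linDZ xsol -(x'sol j) mulN1r -sumrB.
  apply: ler_norm_sum_card => [|p]; first exact: mulr_ge0.
  rewrite -mulrBl normrM -[leRHS]mulr1; apply: ler_pM => //.
    (* The coordinate solved for is one of Sender's, so every Receiver coordinate is within [s]. *)
    rewrite distrC; apply: system_lipschitz => // b v; apply: close.
    by apply/eqP.
  by have /andP[? ?] := x'01 p; rewrite ger0_norm.
rewrite -mulrBr normrM ger0_norm ?(ltW (mu0_gt0 w)) // -[leRHS]mul1r.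
apply: ler_pM => //; [exact: ltW | exact: mu0_le1 |].
have -> : x (w, m) - x' (w, m) = x (w, m) + -1 * x' (w, m) by rewrite mulN1r.
rewrite (BP (fun p => x p + -1 * x' p)) -!mulrA.
apply: ler_norm_sum_card => [|j]; first by rewrite !mulr_ge0.
by rewrite normrM; apply: ler_pM.
Qed.

(** Receiver has no ties after learning any nonempty event, hence none on the path of a
    partition. *)
Definition unique_replies (e : env) := forall (S : {set Omega}) w0 a a',
  w0 \in S -> a != a' ->
  \sum_(w in S) mu0 w * (e (false, a, w) - e (false, a', w)) != 0.

Definition sender_strict (e : env) := forall w a a',
  a != a' -> e (true, a, w) != e (true, a', w).

Definition generic_env : set env := [set e | [/\ cube e, unique_replies e,
  sender_strict e & forall Z E m a a' w0, ~ vertex_bad Z E m a a' w0 e]].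

Lemma generic_conull : (0 < #|A|)%N -> (0 < #|Omega|)%N ->
  lebesgue_null (cube `\` generic_env).
Proof.
move=> /card_gt0P[a0 _] /card_gt0P[w1 _]; have i0 := (true, a0, w1).
pose N1 (k : {set Omega} * Omega * A * A) : set env :=
  [set e | [/\ k.1.1.2 \in k.1.1.1, k.1.2 != k.2, cube e &
   \sum_w (if w \in k.1.1.1 then mu0 w else 0) *
       (e (false, k.1.2, w) - e (false, k.2, w)) = 0]].
pose N2 (k : Omega * A * A) : set env :=
  [set e | [/\ k.1.2 != k.2, cube e &
   \sum_w (w == k.1.1)%:R * (e (true, k.1.2, w) - e (true, k.2, w)) = 0]].
pose N3 (k : {set Omega * M} * {set M * A * A} * M * A * A * Omega) :=
  vertex_bad k.1.1.1.1.1 k.1.1.1.1.2 k.1.1.1.2 k.1.1.2 k.1.2 k.2.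
pose N (i : 'I_3) : set env := nth set0
  [:: \bigcup_k N1 k; \bigcup_k N2 k; \bigcup_k N3 k] i.
have null0 := @lebesgue_null0 R _ i0.
apply: (@lebesgue_null_sub _ _ _ (\bigcup_i N i)).
  move=> e [ce ng]; apply: contrapT => nN; apply: ng; split=> //.
  - move=> S w0 a a' w0S aa'; apply/eqP => eq0; apply: nN.
    exists (Ordinal (isT : (0 < 3)%N)) => //; exists (S, w0, a, a') => //; split=> //=.
    rewrite -[RHS]eq0 [RHS]big_mkcond; apply: eq_bigr => w _.
    by case: ifP => _ //; rewrite mul0r.
  - move=> w a a' aa'; apply/eqP => eq0; apply: nN.
    exists (Ordinal (isT : (1 < 3)%N)) => //; exists (w, a, a') => //; split=> //=.
    by rewrite sum_dirac eq0 subrr.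
  - move=> Z E m a a' w0 bad; apply: nN.
    exists (Ordinal (isT : (2 < 3)%N)) => //.
    by exists (Z, E, m, a, a', w0).
apply: (lebesgue_null_bigcup i0) => -[[|[|[|//]]] ?]; rewrite /N /=;
  apply: (lebesgue_null_bigcup i0).
- move=> [[[S w0] a] a']; have [w0S|w0S] := boolP (w0 \in S); last first.
    by apply: lebesgue_null_sub null0 => e [/=]; rewrite (negbTE w0S).
  have [->|aa'] := eqVneq a a'.
    by apply: lebesgue_null_sub null0 => e [_ /=]; rewrite eqxx.
  apply: (lebesgue_null_sub (N' := [set e : env | cube e /\
     \sum_w (if w \in S then mu0 w else 0) * (e (false, a, w) - e (false, a', w)) = 0])).
    by move=> e [].
  apply: (@hyperplane_null _ _ _ _ w0) => //; first by rewrite w0S gt_eqF.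
  move=> w; case: ifP => _; last by rewrite normr0.
  by rewrite ger0_norm ?mu0_le1 // ltW.
- move=> [[w0 a] a']; have [->|aa'] := eqVneq a a'.
    by apply: lebesgue_null_sub null0 => e [/=]; rewrite eqxx.
  apply: (lebesgue_null_sub (N' := [set e : env | cube e /\
     \sum_w (w == w0)%:R * (e (true, a, w) - e (true, a', w)) = 0])).
    by move=> e [].
  apply: (@hyperplane_null _ _ _ _ w0) => //; first by rewrite eqxx oner_eq0.
  by move=> w; case: eqP; rewrite ?normr1 ?normr0.
- by move=> k; exact: vertex_bad_null.
Qed.

End Genericity.

(** * Comparing commitment and randomization *)

(** The minimum is started at 1, so the bound can also serve as a probability. *)
Lemma finite_pos_lower_bound (R : realType) (K : finType) (P : pred K) (F : K -> R) :
  (forall k, P k -> 0 < F k) ->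
  exists2 eps : R, 0 < eps <= 1 & forall k, P k -> eps <= F k.
Proof.
move=> F0; exists (\big[Num.min/1]_(k | P k) F k); last first.
  by move=> k Pk; exact: bigmin_le_cond.
rewrite bigmin_le_id andbT.
by apply: (big_ind (fun x => 0 < x)) => // x y x0 y0; rewrite lt_min x0.
Qed.

(** * Small diversions of one state to another message *)

Section Divert.
Variables (R : realType) (A Omega M : finType) (mu0 : Omega -> R).

Definition divert (sigma : Omega -> M -> R) w m1 m2 (eps : R) w' m : R :=
  sigma w' m + eps * ((w' == w)%:R * ((m == m2)%:R - (m == m1)%:R)).

Lemma message_value_divert (u : A -> Omega -> R) sigma w m1 m2 eps m a :
  message_value mu0 u (divert sigma w m1 m2 eps) m a =
  message_value mu0 u sigma m a +
  eps * (mu0 w * ((m == m2)%:R - (m == m1)%:R) * u a w).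
Proof.
rewrite -[X in _ + eps * X](sum_dirac w
  (fun v => mu0 v * ((m == m2)%:R - (m == m1)%:R) * u a v)).
rewrite mulr_sumr -big_split; apply: eq_bigr => v _ /=.
by rewrite /divert; ring.
Qed.

Lemma payoff_divert (u : A -> Omega -> R) sigma rho w m1 m2 eps :
  payoff mu0 u (divert sigma w m1 m2 eps) rho = payoff mu0 u sigma rho +
  eps * (mu0 w * (reply_value u rho w m2 - reply_value u rho w m1)).
Proof.
rewrite !payoff_message_value.
transitivity (\sum_m \sum_a rho m a * message_value mu0 u sigma m a +
   \sum_m \sum_a eps * mu0 w * (((m == m2)%:R - (m == m1)%:R) * (rho m a * u a w))).
  rewrite -big_split; apply: eq_bigr => m _; rewrite -big_split.
  by apply: eq_bigr => a _; rewrite message_value_divert /=; ring.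
congr (_ + _); rewrite -(sum_dirac m2 (reply_value u rho w)).
rewrite -(sum_dirac m1 (reply_value u rho w)) -sumrB !mulr_sumr.
apply: eq_bigr => m _; rewrite -mulrBl /reply_value !mulr_sumr.
by apply: eq_bigr => a _; ring.
Qed.

End Divert.

Section Directions.
Variables (R : realType) (A Omega M : finType) (mu0 : Omega -> R).
Hypotheses (mu0_gt0 : forall w, 0 < mu0 w) (mu0_sum : \sum_w mu0 w = 1).
Variable e : (bool * A * Omega)%type -> R.
Local Notation uS := (env_uS e).
Local Notation uR := (env_uR e).
Implicit Types (sigma : Omega -> M -> R) (rho : M -> A -> R).

(* Replies to a partition are strict, so they survive a small deviation by a
   state that would rather send another on-path message. *)
Lemma partitional_optimal_cheap_talk sigma rho :
  (forall i, 0 <= e i <= 1) -> unique_replies mu0 e -> (0 < #|Omega|)%N ->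
  persuasion_profile mu0 uR sigma rho -> partitional sigma ->
  persuasion_optimal mu0 uS uR sigma rho ->
  exists sigma' rho', cheap_talk_eq mu0 uS uR sigma' rho' /\
    persuasion_optimal mu0 uS uR sigma' rho'.
Proof.
move=> cube uniq /card_gt0P[w1 _] [dsig [drho rbr]] /choice[f fP] opt.
have sigE w m : sigma w m = (m == f w)%:R by exact: is_dist_eq1.
have mvE u m a : message_value mu0 u sigma m a =
    \sum_(w in [set w | f w == m]%SET) mu0 w * u a w.
  rewrite /message_value [RHS]big_mkcond; apply: eq_bigr => w _.
  by rewrite inE sigE eq_sym; case: ifP => _; rewrite ?mulr1 // mulr0 mul0r.
have /choice[g gP] : forall m, exists a, 0 < rho m a.
  by move=> m; exact: is_dist_pos.
have rP := proj1 (R_BR_message_value mu0 uR sigma drho) rbr.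
have strict w a : a != g (f w) -> message_value mu0 uR sigma (f w) a <
    message_value mu0 uR sigma (f w) (g (f w)).
  move=> ag; rewrite lt_neqAle rP // andbT -subr_eq0 !mvE -sumrB.
  have := uniq [set v | f v == f w]%SET w a (g (f w)); rewrite inE eqxx => /(_ isT ag).
  by congr (_ != 0); apply: eq_bigr => v _; rewrite mulrBr.
pose onp m := [exists w, f w == m].
(* Off-path messages are answered like the on-path message [f w1], so they offer Sender no new
   deviation. *)
pose h m := if onp m then m else f w1.
have hP m : exists w, h m = f w.
  by rewrite /h; case: ifP => [/existsP[w /eqP <-]|_]; [exists w | exists w1].
have onf w : onp (f w) by apply/existsP; exists w.
have hf w : h (f w) = f w by rewrite /h onf.
have off u m a : ~~ onp m -> message_value mu0 u sigma m a = 0.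
  move=> /existsPn nm; rewrite mvE big1 // => w; rewrite inE => fw.
  by rewrite (negbTE (nm w)) in fw.
pose rho' m a : R := (a == g (h m))%:R.
have drho' : action_strat rho' by move=> m; exact: is_dist_dirac.
have same : payoff mu0 uS sigma rho' = payoff mu0 uS sigma rho.
  rewrite !payoff_message_value; apply: eq_bigr => m _.
  rewrite /rho' sum_dirac; have [om|om] := boolP (onp m); last first.
    by rewrite off // big1 // => a _; rewrite off // mulr0.
  have /existsP[w /eqP fw] := om; rewrite -fw hf.
  rewrite (is_dist_mean_const (c := message_value mu0 uS sigma (f w) (g (f w)))) //.
  move=> a ra; have [->//|ag] := eqVneq a (g (f w)).
  by have := strict w a ag; rewrite ltNge rP.
have opt' : persuasion_optimal mu0 uS uR sigma rho'.
  by move=> s r /opt; rewrite same.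
exists sigma, rho'; split=> //; split=> //; split=> //.
have mvle m a : message_value mu0 uR sigma m a <=
    message_value mu0 uR sigma m (g (h m)).
  have [om|om] := boolP (onp m); last by rewrite !off.
  have /existsP[w /eqP fw] := om; rewrite -fw hf.
  have [->//|ag] := eqVneq a (g (f w)); exact/ltW/strict.
have rho'P m a : 0 < rho' m a -> a = g (h m).
  by rewrite /rho'; case: eqP => //; rewrite ltxx.
split; last by apply/R_BR_message_value => // m a a' /rho'P ->.
have rvE w m : reply_value uS rho' w m = uS (g (h m)) w.
  by rewrite /reply_value sum_dirac.
apply/S_BR_reply_value => // w m m'; rewrite sigE.
case: eqP => [-> _|]; last by rewrite ltxx.
rewrite leNgt; apply/negP; have [w2 hw2] := hP m'.
have -> : reply_value uS rho' w m' = reply_value uS rho' w (f w2).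
  by rewrite !rvE hw2 hf.
move=> better.
(* The margins by which Receiver's on-path replies are strictly best; [eps] is taken below all of
   them. *)
pose gap (p : Omega * A) := message_value mu0 uR sigma (f p.1) (g (f p.1)) -
   message_value mu0 uR sigma (f p.1) p.2.
have [|eps /andP[eps0 eps1] epsP] :=
    @finite_pos_lower_bound R _ (fun p => p.2 != g (f p.1)) gap.
  by move=> [v a] /= ag; rewrite subr_gt0 strict.
(* State [w] sends [f w] with probability 1, so [eps <= 1] leaves nonnegative mass there. *)
have dist_sh : messaging (divert sigma w (f w) (f w2) eps).
  move=> v; split=> [m0|].
    rewrite /divert sigE; case: (eqVneq v w) => [->|_];
      last by rewrite mul0r mulr0 addr0 ler0n.
    by rewrite mul1r; case: eqP; case: eqP => _ _ /=; lra.
  have [_ sv] := dsig v; rewrite big_split /= sv -mulr_sumr -mulr_sumr sumrB.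
  have [_ ->] := is_dist_dirac R (f w2); have [_ ->] := is_dist_dirac R (f w).
  by rewrite subrr !mulr0 addr0.
have : persuasion_profile mu0 uR (divert sigma w (f w) (f w2) eps) rho'.
  split=> //; split=> //; apply/R_BR_message_value => // m0 a a' /rho'P ->.
  rewrite !message_value_divert.
  have [om|om] := boolP (onp m0); last first.
    have /negbTE -> : m0 != f w2 by apply: contraNneq om => ->.
    have /negbTE -> : m0 != f w by apply: contraNneq om => ->.
    by rewrite subrr !mulr0 !mul0r !mulr0 !addr0.
  have /existsP[v /eqP fv] := om; rewrite -fv hf.
  have [->//|ag] := eqVneq a' (g (f v)).
  have := epsP (v, a') ag; rewrite /gap /=.
  set q1 := message_value _ _ _ _ _; set q2 := message_value _ _ _ _ _ => epsq.
  set d := (_ - _); set p1 := uR a' w; set p2 := uR (g (f v)) w.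
  (* The diversion changes a difference of message values by at most [eps], which the gap
     absorbs. *)
  have dd : `|mu0 w * d * (p1 - p2)| <= 1.
    rewrite !normrM -[leRHS]mulr1; apply: ler_pM; rewrite ?mulr_ge0 //.
      rewrite -[leRHS]mulr1; apply: ler_pM => //.
        by rewrite ger0_norm ?(ltW (mu0_gt0 _)) // mu0_le1.
      by rewrite /d; case: eqP; case: eqP => _ _ /=; rewrite ler_norml; lra.
    move: (cube (false, a', w)) (cube (false, g (f v), w)).
    by rewrite -/(uR a' w) -/(uR (g (f v)) w) -/p1 -/p2 ler_norml; lra.
  have : eps * (mu0 w * d * (p1 - p2)) <= eps * 1.
    by rewrite ler_pM2l // (le_trans (ler_norm _)).
  rewrite mulr1 mulrBr mulrBr.
  by move: (eps * (_ * p1)) (eps * (_ * p2)) => y1 y2; lra.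
move/opt'; rewrite payoff_divert gerDl leNgt.
by rewrite !mulr_gt0 // subr_gt0.
Qed.

(** * From cheap talk to partitions *)

Lemma sum_pairs (K1 K2 : finType) (F : K1 * K2 -> R) :
  \sum_p F p = \sum_k1 \sum_k2 F (k1, k2).
Proof. by rewrite pair_bigA; apply: eq_bigr => -[]. Qed.

Lemma lin_message_value (u : A -> Omega -> R) (x : Omega * M -> R) m a a' :
  \sum_p (p.2 == m)%:R * (mu0 p.1 * (u a p.1 - u a' p.1)) * x p =
  message_value mu0 u (fun w m => x (w, m)) m a -
  message_value mu0 u (fun w m => x (w, m)) m a'.
Proof.
rewrite -sumrB sum_pairs; apply: eq_bigr => w _ /=.
under eq_bigr do rewrite -mulrA.
by rewrite (sum_dirac m (fun m' => mu0 w * (u a w - u a' w) * x (w, m'))); ring.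
Qed.

(** With [rho] fixed, [sigma] moves to a vertex of the polytope of strategies within its support to
    which [rho] is a best reply. A Sender indifference on path there would put [e] in some
    [vertex_bad]. *)
Lemma cheap_talk_vertex sigma rho :
  (forall i, 0 <= e i <= 1) ->
  (forall Z E m a a' w0, ~ vertex_bad mu0 (M := M) Z E m a a' w0 e) ->
  cheap_talk_eq mu0 uS uR sigma rho ->
  exists sigma', [/\ messaging sigma',
    forall w m, 0 < sigma' w m -> 0 < sigma w m,
    R_BR mu0 uR sigma' rho &
    forall w m a a', 0 < sigma' w m -> a != a' ->
      message_value mu0 uS sigma' m a != message_value mu0 uS sigma' m a'].
Proof.
move=> cube nbad [dsig [drho [_ rbr]]].
have rP := proj1 (R_BR_message_value mu0 uR sigma drho) rbr.
(* Inequalities of the polytope: nonnegativity, and optimality for Receiver of each action that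
   [rho] plays. *)
pose c (j : Omega * M + M * A * A) (p : Omega * M) : R := match j with
  | inl q => (p == q)%:R
  | inr q => if 0 < rho q.1.1 q.1.2 then
      (p.2 == q.1.1)%:R * (mu0 p.1 * (uR q.1.2 p.1 - uR q.2 p.1)) else 0 end.
have cl x q : lin c x (inl q) = x q by exact: sum_dirac.
have cr x q : lin c x (inr q) = if 0 < rho q.1.1 q.1.2 then
    message_value mu0 uR (fun w m => x (w, m)) q.1.1 q.1.2 -
    message_value mu0 uR (fun w m => x (w, m)) q.1.1 q.2 else 0.
  rewrite /lin /=; case: ifP => _; first exact: lin_message_value.
  by rewrite big1 // => p _; rewrite mul0r.
pose x0 (p : Omega * M) := sigma p.1 p.2.
pose D (d : Omega * M -> R) := forall w, \sum_m d (w, m) = 0.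
have [||||d [Dd xge xact xvert]] := @exists_vertex R _ _ c D x0.
- by move=> w; rewrite big1.
- move=> x y a Dx Dy w.
  by rewrite big_split /= Dx -mulr_sumr Dy mulr0 addr0.
(* The polytope is bounded: a nonnegative direction with zero sum in each state vanishes. *)
- move=> d Dd dge [w m].
  have /psumr_eq0P := Dd w; apply=> // m' _.
  by rewrite -(cl d (w, m')).
- move=> [[w m]|[[m a] a']]; first by rewrite cl; apply: (dsig w).1.
  by rewrite cr /=; case: ifP => // ra; rewrite subr_ge0 rP.
set x := (fun t => x0 t + d t) in xge xact xvert.
pose sigma' w m := x (w, m).
have dsig' : messaging sigma'.
  move=> w; split=> [m|]; first by have := xge (inl (w, m)); rewrite cl.
  by rewrite big_split /= Dd addr0; case: (dsig w).
exists sigma'; split=> //.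
- move=> w m; rewrite !lt_neqAle => /andP[ne _]; case: (dsig w) => -> _; rewrite andbT.
  apply: contraNneq ne => /esym s0; have := xact (inl (w, m)).
  by rewrite !cl => /(_ s0) /esym/eqP.
- apply/R_BR_message_value => // m a a' ra.
  by have := xge (inr (m, a, a')); rewrite cr /= ra subr_ge0.
move=> w0 m a a' sw0 aa'; rewrite -subr_eq0; apply/eqP => eq0.
(* [Z] and [E] collect the constraints tight at [x]; the vertex property then gives injectivity of
   their system. *)
pose Z := [set p | x p == 0]%SET.
pose E := [set q | (0 < rho q.1.1 q.1.2) && (lin c x (inr q) == 0)]%SET.
have sZ y q : lin (system mu0 Z E e) y (inl (inl q)) = if q \in Z then y q else 0.
  rewrite /lin /=; case: ifP => _; first exact: sum_dirac.
  by rewrite big1 // => p _; rewrite mul0r.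
have sS y w : lin (system mu0 Z E e) y (inl (inr w)) = \sum_m y (w, m).
  rewrite /lin /= sum_pairs /=; under eq_bigr do rewrite -mulr_sumr.
  exact: (sum_dirac w (fun w => \sum_m y (w, m))).
have sE y q : lin (system mu0 Z E e) y (inr q) = if q \in E then lin c y (inr q) else 0.
  rewrite cr /lin /=; case: ifP => [|_]; last by rewrite big1 // => p _; rewrite mul0r.
  by rewrite inE => /andP[-> _]; exact: lin_message_value.
apply: (nbad Z E m a a' w0); split=> //.
  move=> y y0; apply: xvert; first by move=> w; rewrite -sS.
  move=> [q|q]; rewrite ?cl => act0.
    by have := y0 (inl (inl q)); rewrite sZ inE act0 eqxx.
  have := y0 (inr q); rewrite sE inE act0 eqxx andbT.
  by case: ifP => // rq _; rewrite cr rq.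
exists x; split.
- by move=> [w m']; have [s0 _] := dsig' w; rewrite s0 (is_dist_le1 m' (dsig' w)).
- move=> [[q|w]|q] /=; rewrite ?sZ ?sS ?sE.
  + by rewrite inE; case: eqP.
  + by case: (dsig' w).
  + by rewrite inE; case: ifP => // /andP[_ /eqP].
- by rewrite gt_eqF.
rewrite -[RHS]eq0 -sumrB; apply: eq_bigr => w _.
by rewrite /sigma' /env_uS; ring.
Qed.

(* Optimality makes Sender indifferent over the support of each reply; at a
   vertex such an indifference is non-generic, so all replies are pure. *)
Lemma cheap_talk_optimal_partitional sigma rho :
  generic_env M mu0 e -> (0 < #|Omega|)%N -> cheap_talk_eq mu0 uS uR sigma rho ->
  persuasion_optimal mu0 uS uR sigma rho ->
  exists sigma' rho', (persuasion_profile mu0 uR sigma' rho' /\ partitional sigma') /\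
    persuasion_optimal mu0 uS uR sigma' rho'.
Proof.
move=> [cube _ strictS nbad] /card_gt0P[w1 _] ct opt0.
have [s [ds sub rbr noind]] := cheap_talk_vertex cube nbad ct.
have [dsig [drho [sbr0 _]]] := ct.
have sP w m m' : 0 < s w m -> reply_value uS rho w m' <= reply_value uS rho w m.
  by move/sub; apply: (proj1 (S_BR_reply_value uS rho mu0_gt0 dsig)).
have sbr : S_BR mu0 uS s rho by apply/S_BR_reply_value.
have opt : persuasion_optimal mu0 uS uR s rho.
  by move=> s' r' /opt0 /le_trans; apply; exact: sbr.
have rP := proj1 (R_BR_message_value mu0 uR s drho) rbr.
have indiff m a : 0 < rho m a -> message_value mu0 uS s m a =
    \sum_b rho m b * message_value mu0 uS s m b.
  have le b : 0 < rho m b -> message_value mu0 uS s m b <=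
      \sum_b rho m b * message_value mu0 uS s m b.
    (* Replacing the reply at [m] by an action [b] in its support keeps it a best reply, so
       optimality bounds the value of [b] by the mean. Equality follows since the mean averages
       these values. *)
    move=> rb; pose r m' a' : R := if m' == m then (a' == b)%:R else rho m' a'.
    have dr : action_strat r.
      by move=> m'; rewrite /r; case: eqP => _ //; exact: is_dist_dirac.
    have : persuasion_profile mu0 uR s r.
      split=> //; split=> //; apply/R_BR_message_value => // m' a1 a2; rewrite /r.
      case: eqP => [->|_]; last exact: rP.
      by case: eqP => [-> _|_]; [exact: rP | rewrite ltxx].
    move/opt; rewrite !payoff_message_value (bigD1 m) //= [leRHS](bigD1 m) //=.
    rewrite {1}/r eqxx sum_dirac.
    rewrite (eq_bigr (fun m' => \sum_a' rho m' a' * message_value mu0 uS s m' a')).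
      by rewrite lerD2r.
    by move=> m' /negbTE mm'; rewrite /r mm'.
  set mean := (X in _ = X) in le *; have [r0 r1] := drho m.
  have : \sum_b rho m b * (mean - message_value mu0 uS s m b) = 0.
    under eq_bigr do rewrite mulrBr.
    by rewrite sumrB -mulr_suml r1 mul1r subrr.
  have ge0 b : true -> 0 <= rho m b * (mean - message_value mu0 uS s m b).
    move=> _; have := r0 b; rewrite le_eqVlt => /orP[/eqP <-|rb].
      by rewrite mul0r.
    by rewrite mulr_ge0 // subr_ge0 le.
  move=> /(psumr_eq0P ge0) eq0 ra; apply/esym/eqP; rewrite -subr_eq0.
  by have /eqP := eq0 a isT; rewrite mulf_eq0 (gt_eqF ra).
have pure w m a a' : 0 < s w m -> 0 < rho m a -> 0 < rho m a' -> a = a'.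
  move=> sw ra ra'; apply/eqP; apply: contraT => aa'.
  by have := noind w m a a' sw aa'; rewrite (indiff m a) // (indiff m a') // eqxx.
have /choice[act actP] : forall m, exists a, 0 < rho m a.
  by move=> m; exact: is_dist_pos.
have /choice[mw mwP] : forall w, exists m, 0 < s w m.
  by move=> w; exact: is_dist_pos.
have rvE w v m : 0 < s v m -> reply_value uS rho w m = uS (act m) w.
  move=> sv; apply: is_dist_mean_const => // a ra.
  by rewrite (pure v m a (act m)).
pose f w := act (mw w).
(* Messages sent in one state give Sender equal utility there, so strict preferences make them
   induce the same action. *)
have fP w m : 0 < s w m -> act m = f w.
  move=> sw; apply/eqP; apply: contraT => ne; have /eqP[] := strictS w _ _ ne.
  rewrite -/(uS (act m) w) -/(uS (f w) w) -(rvE w _ _ sw) -(rvE w _ _ (mwP w)).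
  by apply: le_anti; rewrite !sP.
(* One representative message per induced action; the default arises only for actions that no state
   induces. *)
pose r a := if [pick w | f w == a] is Some w then mw w else mw w1.
have rf w : exists2 v, 0 < s v (r (f w)) & act (r (f w)) = f w.
  rewrite /r; case: pickP => [v /eqP fv|/(_ w)]; last by rewrite eqxx.
  by exists v.
pose h w := r (f w).
pose s' w m : R := (m == h w)%:R.
have ds' : messaging s' by move=> w; exact: is_dist_dirac.
(* The new message pools all old messages that induce the same action. Its values are sums of
   theirs, so that action remains optimal for Receiver. *)
have mvE w b : message_value mu0 uR s' (h w) b =
    \sum_(m | act m == f w) message_value mu0 uR s m b.
  rewrite exchange_big; apply: eq_bigr => v _.
  rewrite -mulr_suml -mulr_sumr; congr (_ * _ * _).
  have -> : s' v (h w) = (f v == f w)%:R.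
    rewrite /s' /h; congr (nat_of_bool _)%:R.
    apply/eqP/eqP => [hh|->//].
    by have [_ _ <-] := rf v; have [_ _ <-] := rf w; rewrite hh.
  have [sv0 sv1] := ds v; case: eqP => fvw.
    transitivity (\sum_m s v m); first by rewrite sv1.
    rewrite [RHS]big_mkcond; apply: eq_bigr => m _; case: eqP => // am.
    apply: le_anti; rewrite sv0 andbT leNgt; apply/negP => /fP.
    by rewrite fvw.
  rewrite big1 // => m /eqP am; apply: le_anti; rewrite sv0 andbT leNgt.
  by apply/negP => /fP; rewrite am => /esym.
exists s', rho; split; [split|].
- split=> //; split=> //; apply/R_BR_message_value => // m a a' ra.
  (* A message that [s'] never sends has value 0 for every action, so any reply to it is optimal. *)
  have [/existsP[w /eqP hw]|/existsPn nh] := boolP [exists w, h w == m].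
    rewrite -hw !mvE; apply: ler_sum => m' /eqP am'; apply: rP.
    have [v sv av] := rf w; rewrite -hw in ra.
    have -> // : a = act m' by rewrite am' -av; exact: (pure v (h w)).
  have E b : message_value mu0 uR s' m b = 0.
    rewrite /message_value big1 // => w _.
    by rewrite /s' eq_sym (negbTE (nh w)) mulr0 mul0r.
  by rewrite !E.
- by move=> w; exists (h w); rewrite /s' eqxx.
suff same : payoff mu0 uS s' rho = payoff mu0 uS s rho.
  by move=> s2 r2 /opt; rewrite same.
rewrite !payoff_reply_value; apply: eq_bigr => w _.
rewrite /s' sum_dirac; apply/esym/is_dist_mean_const => // m sw.
have [v sv av] := rf w.
by rewrite (rvE w w m) // (rvE w v (h w)) // (fP w m) // /h av.
Qed.

End Directions.

Theorem theorem1 (R : realType) (A Omega M : finType)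
  (mu0 : Omega -> R) :
  (0 < #|A|)%N -> (0 < #|Omega|)%N ->
  (forall w, 0 < mu0 w) -> \sum_(w : Omega) mu0 w = 1 ->
  (maxn #|Omega| #|A| < #|M|)%N ->
  exists G : set ((bool * A * Omega)%type -> R),
    G `<=` [set e | forall i, 0 <= e i <= 1] /\
    lebesgue_null ([set e | forall i, 0 <= e i <= 1] `\` G) /\
    forall e, G e ->
      (commitment_valuable M mu0 (env_uS e) (env_uR e) <->
       values_randomization M mu0 (env_uS e) (env_uR e)).
Proof.
move=> A0 O0 mu0_gt0 mu0_sum cardM; exists (generic_env M mu0).
split; first by move=> e [].
split; first exact: generic_conull.
have M0 : (0 < #|M|)%N by exact: leq_ltn_trans cardM.
move=> e Ge; suff [CR RC] : ~ commitment_valuable M mu0 (env_uS e) (env_uR e) <->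
    ~ values_randomization M mu0 (env_uS e) (env_uR e).
  by split=> H; apply: contrapT; [move/RC | move/CR].
rewrite not_commitment_valuable // not_values_randomization //.
split=> -[s [r []]].
  exact: cheap_talk_optimal_partitional.
have [cube uniq _ _] := Ge.
by move=> -[]; exact: partitional_optimal_cheap_talk.
Qed.
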